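(* The star Menger property is not necessarily inherited by open sets, nor by dense sets, nor even by open dense sets. That is: there exist a star Menger space and an open subset of it which is not star Menger; there exist a star Menger space and a dense subset of it which is not star Menger; and there exist a star Menger space and an open dense subset of it which is not star Menger (all subsets carrying the subspace topology).
   Context: All spaces are assumed to be regular and $T_1$. For a family $\mathcal{U}$ of subsets of $X$ and $A\subseteq X$, $St(A,\mathcal{U})=\bigcup\{U\in\mathcal{U}:U\cap A\neq\emptyset\}$. A space $M$ is Menger if for every sequence $\{\mathcal{U}_n:n\in\omega\}$ of open covers of $M$ there are finite subcollections $\mathcal{V}_n\subseteq\mathcal{U}_n$ ($n\in\omega$) such that $\bigcup\{\mathcal{V}_n:n\in\omega\}$ is an open cover of $M$. A space $X$ is star Menger if for every open cover $\mathcal{U}$ of $X$ there is a subspace $M\subseteq X$ which is Menger and satisfies $St(M,\mathcal{U})=X$. *)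

(* Defs.v *)
From HB Require Import structures.
From mathcomp Require Import all_boot all_order all_algebra.
From mathcomp Require Import boolp classical_sets functions cardinality topology.

Set Implicit Arguments.
Unset Strict Implicit.
Unset Printing Implicit Defensive.

Local Open Scope classical_set_scope.

Definition open_cover (X : topologicalType) (U : set (set X)) : Prop :=
  (forall u, U u -> open u) /\ \bigcup_(u in U) u = setT.

Definition star (X : Type) (A : set X) (U : set (set X)) : set X :=
  \bigcup_(u in [set u | U u /\ u `&` A !=set0]) u.

Definition menger (X : topologicalType) : Prop :=
  forall U : nat -> set (set X), (forall n, open_cover (U n)) ->
  exists V : nat -> set (set X),
    (forall n, V n `<=` U n /\ finite_set (V n)) /\
    open_cover (\bigcup_n V n).

(* A subset [M] of [X] is viewed as a space through [set_type M], which carries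
   the subspace topology (unlike [subspace M], whose carrier is all of [X]). *)
Definition star_menger (X : topologicalType) : Prop :=
  forall U : set (set X), open_cover U ->
  exists M : set X, menger (set_type M) /\ star M U = setT.

Definition regular_T1 (X : topologicalType) : Prop :=
  regular_space X /\ accessible_space X.

(* Main.v *)
(* In the one-point compactification of an uncountable discrete space, the
   discrete space itself is open and dense. The compactification is star
   Menger, as is every compact space: pick one point in each member of a finite
   subcover. In the discrete space, only the whole space has full star with
   respect to the cover by singletons, so star Menger would imply Menger, hence
   countable. *)
From HB Require Import structures.
Require Import Defs.
From mathcomp Require Import all_boot all_order all_algebra.
From mathcomp Require Import boolp classical_sets functions cardinality topology.
From mathcomp Require Import finmap.

Local Open Scope classical_set_scope.

(** The cover [U 0] alone suffices: one member through each point is a finite selection that covers,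
    so all later selections may be empty. *)
Lemma finite_menger (X : topologicalType) : finite_set [set: X] -> menger X.
Proof.
move=> finX U Ucov.
have /choice [u uP] (x : X) : exists v, U 0%N v /\ v x.
  have [_ UT] := Ucov 0%N.
  have : (\bigcup_(v in U 0%N) v) x by rewrite UT.
  by case=> v Uv vx; exists v.
exists (fun n => if n is 0%N then range u else set0); split.
  case=> [|n]; last by split; [exact: sub0set|exact: finite_set0].
  by split; [move=> _ [x _ <-]; exact: (uP x).1|exact: finite_image].
split.
  move=> v [[|n] _ //= [x _ <-]].
  by have [+ _] := Ucov 0%N; apply; exact: (uP x).1.
apply/seteqP; split=> // x _; exists (u x); last exact: (uP x).2.
by exists 0%N => //; exists x.
Qed.

Lemma compact_star_menger (X : topologicalType) :
  compact [set: X] -> star_menger X.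
Proof.
move=> cX U [Uo UT].
have [[x0 _]|/nonemptyPn X0] := pselect ([set: X] !=set0); last first.
  exists set0; split.
    by apply: finite_menger; rewrite (eq_finite_set (card_setT _)).
  by rewrite X0; apply/seteqP; split=> // x _; rewrite -X0.
(* The passage to [cover_compact] is made over a pointed type; [x0] supplies the point, hence the
   separate treatment of the empty space. *)
pose pX : ptopologicalType := HB.pack X (isPointed.Build X x0).
have {}cX : @cover_compact pX setT by rewrite -compact_cover.
have /choice [u uP] (x : X) : exists v, U v /\ v x.
  have : (\bigcup_(v in U) v) x by rewrite UT.
  by case=> v Uv vx; exists v.
have uo x : [set: X] x -> open (u x) by move=> _; exact/Uo/(uP x).1.
have ucov : [set: X] `<=` cover setT u.
  by move=> x _; exists x => //; exact: (uP x).2.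
(* The cover is indexed by points with [x] in [u x], so the finite index set [D] is itself the
   required Menger subspace: each chosen [u d] meets it at [d]. *)
have [D _ Dcov] := cX _ _ _ uo ucov.
exists [set` D]; split.
  apply: finite_menger; rewrite (eq_finite_set (card_setT _)).
  exact: finite_fset.
apply/seteqP; split=> // x _; have [d Dd udx] := Dcov x I.
exists (u d) => //; split; first exact: (uP d).1.
by exists d; split=> //; exact: (uP d).2.
Qed.

Lemma open_cover_set1 (X : topologicalType) :
  (forall x : X, open [set x]) -> open_cover (range (@set1 X)).
Proof.
move=> oX; split; first by move=> _ [x _ <-].
by apply/seteqP; split=> // x _; exists [set x] => //; exists x.
Qed.

(** Take the singleton cover at every stage. No proper subfamily of it covers, so the countable
    union of finite selections contains every singleton. *)
Lemma discrete_menger_countable (X : topologicalType) :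
  (forall x : X, open [set x]) -> menger X -> countable [set: X].
Proof.
move=> oX mX.
have [V [VU [_ VT]]] := mX _ (fun=> open_cover_set1 X oX).
have VTc : range (@set1 X) `<=` \bigcup_n V n.
  move=> _ [x _ <-].
  have : (\bigcup_(u in \bigcup_n V n) u) x by rewrite VT.
  case=> v [n _ Vv] vx; exists n => //.
  by have [y _ yv] := (VU n).1 _ Vv; move: Vv vx; rewrite -yv => + -> .
have : countable (range (@set1 X)).
  apply: sub_countable (subset_card_le VTc) _.
  apply: bigcup_countable; first exact: countableP.
  by move=> n _; exact/finite_set_countable/(VU n).2.
rewrite (eq_countable (inj_card_eq _)) // => x y _ _ xy.
by have : [set y] x by rewrite -xy.
Qed.

Lemma discrete_star_menger_countable (X : topologicalType) :
  (forall x : X, open [set x]) -> star_menger X -> countable [set: X].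
Proof.
move=> oX smX.
have [M [mM starM]] := smX _ (open_cover_set1 X oX).
have MT : M = setT.
  apply/seteqP; split=> // x _.
  have : star M (range (@set1 X)) x by rewrite starM.
  by case=> _ [[y _ <-] [_ [-> My]]] ->.
have cM : countable [set: M].
  apply: discrete_menger_countable mM => x.
  exists [set set_val x]; first exact: oX.
  by apply/seteqP; split=> y /=; [move/val_inj|move->].
by move: cM; rewrite (eq_countable (card_setT M)) MT.
Qed.

Lemma not_countable_set_nat : ~ countable [set: set nat].
Proof.
move=> /countable_injP [f finj].
(* Cantor's diagonal set: the codes of sets that omit their own code. By injectivity of [f], only
   [D] has code [f D]. *)
pose D := [set n | exists2 A, f A = n & ~ A n].
have DP : D (f D) <-> ~ D (f D).
  split=> [[A fA nA]|nD]; last by exists D.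
  have AD : A = D by exact: finj (mem_setT _) (mem_setT _) fA.
  by move: nA; rewrite AD.
by have nD : ~ D (f D); [move=> DD; exact: (DP.1 DD)|exact/nD/DP].
Qed.

Lemma open_dense_not_star_menger :
  exists (X : topologicalType) (A : set X),
    [/\ regular_T1 X, star_menger X, open A, dense A &
        ~ star_menger (set_type A)].
Proof.
pose T := discrete_topology (set nat).
pose X : topologicalType := one_point_compactification T.
have cX : compact [set: X] by exact: one_point_compactification_compact.
(* Local compactness and separation of [T] are what make the compactification Hausdorff; regularity
   then follows from compactness. *)
have lcT : locally_compact [set: T].
  move=> x _; rewrite withinET; exists [set x]; first exact: discrete_set1.
  by split; [exact: compact_set1|exact: discrete_closed].
have hX : hausdorff_space X.
  apply: one_point_compactification_hausdorff => //.
  exact: discrete_hausdorff.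
have oS (B : set T) : @open X (Some @` B).
  exact/one_point_compactification_open_some/discrete_open.
pose A : set X := range (@Some T).
exists X, A; split.
- split; last exact: hausdorff_accessible.
  by move=> x; apply: (compact_regular hX cX); exact: filterT.
- exact: compact_star_menger.
- exact: oS.
- move=> O [x Ox] oO; case: x Ox => [x|] Ox.
    by exists (Some x); split=> //; exists x.
  (* An open set around infinity contains the complement of a compact [C]. Were [C] everything, [T]
     would be compact, so star Menger and countable; hence some [y] lies outside [C]. *)
  move: oO; rewrite openE => /(_ _ Ox) [C [cC _] CO].
  have /existsNP [y nCy] : ~ forall y, C y.
    move=> CT; apply: not_countable_set_nat.
    apply: (@discrete_star_menger_countable T) => [y|].
      exact: discrete_open.
    apply: compact_star_menger.
    by have <- : C = setT by apply/seteqP; split=> y _; [|exact: CT].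
  by exists (Some y); split; [apply: CO; left; exists y|exists y].
- move=> /discrete_star_menger_countable cA; apply: not_countable_set_nat.
  (* Countability is carried from the subspace type to [A], then to [set nat] along the injection
     [Some]. Singletons of the subspace are traces of the open sets [[set Some y]]. *)
  rewrite -(eq_countable (inj_card_eq (f := @Some T) _)); last first.
    by move=> x y _ _ [].
  rewrite -(eq_countable (card_setT _)); apply: cA => -[x Ax].
  have [y _ yx] := set_mem Ax.
  exists [set Some y]; first by rewrite -image_set1; exact: oS.
  apply/seteqP; split=> z /=; [move=> zy|by move->].
  by apply: val_inj; rewrite /= -yx.
Qed.

Theorem proposition4p2 :
  (exists (X : topologicalType) (A : set X),
     [/\ regular_T1 X, star_menger X, open A & ~ star_menger (set_type A)]) /\
  (exists (X : topologicalType) (A : set X),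
     [/\ regular_T1 X, star_menger X, dense A & ~ star_menger (set_type A)]) /\
  (exists (X : topologicalType) (A : set X),
     [/\ regular_T1 X, star_menger X, open A, dense A &
         ~ star_menger (set_type A)]).
Proof.
have [X [A [rX sX oA dA nA]]] := open_dense_not_star_menger.
by split; [|split]; exists X, A.
Qed.
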